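(* Let $n,s\ge1$ be integers, let $q_n=x_1^2+\cdots+x_n^2$, let $\mathbf{a}\in\mathbb{C}^n$ be an isotropic point, i.e. $\mathbf{a}\cdot\mathbf{a}=\sum_i a_i^2=0$, and let $$f=q_n^{[s]}-(\mathbf{a}\cdot\mathbf{x})^{[2s]}.$$ Then the middle catalecticant $\operatorname{Cat}_{f,s}$ of $f$ has full rank.
   Context: Let $\mathcal{R}_{n,d}$ and $\mathcal{D}_{n,d}$ be the spaces of homogeneous polynomials of degree $d$ in $\mathbb{C}[x_1,\dots,x_n]$ and $\mathbb{C}[y_1,\dots,y_n]$ respectively. For $\phi\in\mathbb{C}[y_1,\dots,y_n]$ and $f\in\mathbb{C}[x_1,\dots,x_n]$, $\phi\circ f=\phi(\partial/\partial x_1,\dots,\partial/\partial x_n)f$. For $f\in\mathcal{R}_{n,2s}$, the middle catalecticant is the linear map $\operatorname{Cat}_{f,s}\colon\mathcal{D}_{n,s}\to\mathcal{R}_{n,s}$, $\phi\mapsto\phi\circ f$. Notation: $q_n^{[s]}=\frac{1}{2^ss!}q_n^s$; $\mathbf{a}\cdot\mathbf{x}=\sum_i a_ix_i$; $(\mathbf{a}\cdot\mathbf{x})^{[2s]}=\frac{1}{(2s)!}(\mathbf{a}\cdot\mathbf{x})^{2s}$. *)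

(* Defs.v *)
From HB Require Import structures.
From mathcomp Require Import all_boot all_order all_algebra.
From mathcomp Require Import reals complex.
From mathcomp Require Import ssrcomplements mpoly.

Set Implicit Arguments.
Unset Strict Implicit.
Unset Printing Implicit Defensive.

Import GRing.Theory.
Local Open Scope ring_scope.

(* The rings C[x_1, ..., x_n] and C[y_1, ..., y_n] are both {mpoly F[n]}, and
   the spaces R_{n,d} and D_{n,d} are both [dhomog n F d].  The library equips
   the latter with a vector space structure when the number of variables has
   the form n.+1. *)

Section Apolarity.
Variables (F : fieldType) (n : nat).

Definition apolar_act (phi f : {mpoly F[n]}) : {mpoly F[n]} :=
  \sum_(m <- msupp phi) phi@_m *: f^`M[m].

Lemma apolar_actE (phi f : {mpoly F[n]}) k : (msize phi <= k)%N ->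
  apolar_act phi f = \sum_(m : 'X_{1..n < k}) phi@_m *: f^`M[m].
Proof.
move=> lek; rewrite /apolar_act (big_mksub 'X_{1..n < k}) //=.
- rewrite [RHS](bigID (fun m : 'X_{1..n < k} => (m : 'X_{1..n}) \in msupp phi)).
  rewrite /= [X in _ = _ + X]big1 ?addr0 // => m.
  by move/memN_msupp_eq0 ->; rewrite scale0r.
- exact: msupp_uniq.
- by move=> m /msize_mdeg_lt /leq_trans; apply.
Qed.

Lemma apolar_act_is_linear (f : {mpoly F[n]}) : linear (apolar_act^~ f).
Proof.
move=> c phi psi /=.
pose k := maxn (msize (c *: phi + psi)) (maxn (msize phi) (msize psi)).
rewrite !(@apolar_actE _ f k) ?leq_max ?leqnn ?orbT // scaler_sumr -big_split.
by apply: eq_bigr => m _; rewrite mcoeffD mcoeffZ scalerDl scalerA.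
Qed.

Lemma apolar_act_homog d e (phi f : {mpoly F[n]}) :
  phi \is d.-homog -> f \is (d + e).-homog -> apolar_act phi f \is e.-homog.
Proof.
move=> /dhomogP hphi /dhomogP hf; rewrite /apolar_act big_seq.
apply: rpred_sum => m /hphi /= dm; apply: rpredZ.
apply/dhomogP => m'; rewrite mcoeff_msupp mcoeff_mderivm => nz.
have /hf /= : (m + m')%MM \in msupp f.
  by rewrite mcoeff_msupp; apply: contra nz => /eqP ->; rewrite mul0rn.
by rewrite mdegD dm => /addnI.
Qed.

End Apolarity.

Section Catalecticant.
Variables (F : fieldType) (n s : nat).

Lemma cat_homog (f : dhomog n.+1 F (2 * s)) (phi : dhomog n.+1 F s) :
  apolar_act phi f \is s.-homog.
Proof.
apply: (@apolar_act_homog _ _ s); first exact: dhomog_is_dhomog.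
by rewrite addnn -mul2n; exact: dhomog_is_dhomog.
Qed.

Definition cat_fun (f : dhomog n.+1 F (2 * s)) (phi : dhomog n.+1 F s) :
  dhomog n.+1 F s := DHomog (cat_homog f phi).

Lemma cat_fun_is_linear f : linear (cat_fun f).
Proof. by move=> c phi psi; apply: val_inj; rewrite /= apolar_act_is_linear. Qed.

HB.instance Definition _ f :=
  GRing.isLinear.Build F (dhomog n.+1 F s) (dhomog n.+1 F s) _ (cat_fun f)
    (cat_fun_is_linear f).

Definition Cat (f : dhomog n.+1 F (2 * s)) :
  'Hom(dhomog n.+1 F s, dhomog n.+1 F s) := linfun (cat_fun f).

Lemma CatE f phi : Cat f phi = apolar_act phi f :> {mpoly F[n.+1]}.
Proof. by rewrite lfunE. Qed.

End Catalecticant.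

Definition full_rank (F : fieldType) (U V : vectType F) (h : 'Hom(U, V)) : Prop :=
  \dim (limg h) = minn (\dim {:U}) (\dim {:V}).

Section Forms.
Variables (F : fieldType) (n : nat).

Definition qform : {mpoly F[n]} := \sum_(i < n) 'X_i ^+ 2.

Definition linform (a : 'rV[F]_n) : {mpoly F[n]} := \sum_(i < n) a 0 i *: 'X_i.

Definition isotropic (a : 'rV[F]_n) : Prop := \sum_(i < n) a 0 i ^+ 2 = 0.

Lemma qform_homog : qform \is 2.-homog.
Proof.
apply: rpred_sum => i _; rewrite -[2%N]mul1n; apply: dhomogMn.
by rewrite dhomogX /= mdeg1.
Qed.

Lemma linform_homog a : linform a \is 1.-homog.
Proof. by apply: rpred_sum => i _; rewrite rpredZ // dhomogX /= mdeg1. Qed.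

Lemma qform_dpow_homog s :
  ((2 ^ s * s`!)%:R : F)^-1 *: qform ^+ s \is (2 * s).-homog.
Proof. exact/rpredZ/dhomogMn/qform_homog. Qed.

Lemma linform_dpow_homog a d : (d`!%:R : F)^-1 *: linform a ^+ d \is d.-homog.
Proof. by rewrite rpredZ //; have := dhomogMn d (linform_homog a); rewrite mul1n. Qed.

(* q_n^[s] and (a . x)^[d]; the two bracketed powers are normalized
   differently, by 1 / (2^s s!) and by 1 / d! respectively. *)
Definition qform_dpow s : dhomog n F (2 * s) := DHomog (qform_dpow_homog s).

Definition linform_dpow a d : dhomog n F d := DHomog (linform_dpow_homog a d).

End Forms.

Arguments qform_dpow F n s : clear implicits.

(* Main.v *)
Require Import Defs.
From HB Require Import structures.
From mathcomp Require Import all_boot all_order all_algebra.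
From mathcomp Require Import reals complex.
From mathcomp Require Import mpoly ring.

(** Write Q_k and L_k for the divided powers of q = sum X_i^2 and of the linear
    form L = a . X.  On forms of degree s, the catalecticant of f = Q_s - L_2s
    is that of Q_s minus the rank one map phi |-> phi(a) L_s, since
    phi o L_2s = phi(a) L_s ([apolar_linform_dpow]).  Source and target
    coincide, so full rank means injectivity; let phi be in the kernel, that is,
    phi o Q_s = phi(a) L_s.

    The isotropy of a kills the perturbation.  As L(d) is a derivation with
    L(d) L = a . a = 0 and L(d) Q_{k+1} = L Q_k, the operator L^s sends Q_s to
    L^s; and it sends L_s to L(a)^s = (a . a)^s = 0, because s > 0.  Apolar
    actions commute, so applying L^s to the kernel equation gives
    0 = phi o L^s = s! phi(a) ([apolar_eq_meval_isotropic]).  Hence phi(a) = 0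
    and phi o Q_s = 0.

    It remains to see that the catalecticant of Q_s is injective
    ([apolar_qform_dpow_inj]).  The identity
      phi o Q_d = sum_k Q_k (Q_k o phi)     for phi of degree d
    ([apolar_act_qform_dpow]) is the degree d part of
    phi(d) e^{q/2} = e^{q/2} (e^{Delta/2} phi), where Q_k acts as
    Delta^k / (2^k k!).  In the Hermitian product <f, g> = (f o conj g)(0), in
    which the monomials are orthogonal of positive norm, multiplication by Q_k
    is adjoint to the action of Q_k, so
    <phi o Q_d, phi> = sum_k <Q_k o phi, Q_k o phi>.
    All terms are nonnegative, and the one for k = 0 is <phi, phi>. *)

Set Implicit Arguments.
Unset Strict Implicit.
Unset Printing Implicit Defensive.

Import GRing.Theory Num.Theory.

Local Open Scope ring_scope.

(** * The apolar action of differential operators *)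

Section ApolarModule.
Variables (F : fieldType) (n : nat).
Implicit Types (phi psi f g : {mpoly F[n]}) (m : 'X_{1..n}).

Lemma apolar_actDl phi psi f :
  apolar_act (phi + psi) f = apolar_act phi f + apolar_act psi f.
Proof. by have := apolar_act_is_linear f 1 phi psi; rewrite !scale1r. Qed.

Lemma apolar_act0l f : apolar_act 0 f = 0.
Proof. by rewrite /apolar_act msupp0 big_nil. Qed.

Lemma apolar_actZl c phi f : apolar_act (c *: phi) f = c *: apolar_act phi f.
Proof.
by have := apolar_act_is_linear f c phi 0; rewrite !addr0 apolar_act0l addr0.
Qed.

Lemma apolar_act_suml I (r : seq I) (P : pred I) (G : I -> {mpoly F[n]}) f :
  apolar_act (\sum_(i <- r | P i) G i) f =
  \sum_(i <- r | P i) apolar_act (G i) f.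
Proof.
apply: (big_morph (fun phi => apolar_act phi f)) => [phi psi|].
  exact: apolar_actDl.
exact: apolar_act0l.
Qed.

Lemma apolar_act_linearr phi : linear (apolar_act phi).
Proof.
move=> c f g; rewrite /apolar_act scaler_sumr -big_split; apply: eq_bigr => m _.
by rewrite linearP scalerDr !scalerA mulrC.
Qed.

HB.instance Definition _ phi :=
  GRing.isLinear.Build F {mpoly F[n]} {mpoly F[n]} _ (apolar_act phi)
    (apolar_act_linearr phi).

Lemma apolar_actXm m f : apolar_act 'X_[m] f = f^`M[m].
Proof. by rewrite /apolar_act msuppX big_seq1 mcoeffX eqxx scale1r. Qed.

Lemma apolar_actX i f : apolar_act 'X_i f = f^`M(i).
Proof. by rewrite apolar_actXm mderivmU1m. Qed.

Lemma apolar_act1 f : apolar_act 1 f = f.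
Proof. by rewrite -mpolyX0 apolar_actXm mderivm0m. Qed.

Lemma apolar_actM phi psi f :
  apolar_act (phi * psi) f = apolar_act phi (apolar_act psi f).
Proof.
rewrite [phi]mpolyE mulr_suml !apolar_act_suml; apply: eq_bigr => m _.
rewrite [psi]mpolyE mulr_sumr !apolar_act_suml linear_sum /=.
apply: eq_bigr => l _.
rewrite -scalerAr -scalerAl -mpolyXD !apolar_actZl /= !apolar_actXm.
by rewrite addmC mderivmDm mderivmZ !scalerA mulrC.
Qed.

Lemma apolar_actC phi psi f :
  apolar_act phi (apolar_act psi f) = apolar_act psi (apolar_act phi f).
Proof. by rewrite -!apolar_actM mulrC. Qed.

Lemma mnm_ind (P : 'X_{1..n} -> Prop) :
  P 0%MM -> (forall i m, P m -> P (U_(i) + m)%MM) -> forall m, P m.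
Proof.
move=> P0 PS m; have [d] := ubnP (mdeg m); elim: d m => // d IH m.
have [/eqP -> //|] := boolP (m == 0%MM).
rewrite -mdeg_eq0 mdegE sum_nat_eq0 negb_forall => /existsP[i /= mi].
have [m' ->] : exists m', m = (U_(i) + m')%MM.
  by exists (m - U_(i))%MM; rewrite addmC submK // lep1mP.
rewrite -mdegE mdegD mdeg1 add1n ltnS => lemd.
exact/PS/IH.
Qed.

(** Unlike the induction that adds one monomial at a time, this one multiplies
    by one variable, so that each step of a proof about [apolar_act] costs a
    single derivative. *)
Lemma mpoly_indX (P : {mpoly F[n]} -> Prop) :
    P 0 -> P 1 -> (forall i p, P p -> P ('X_i * p)) ->
    (forall c p q, P p -> P q -> P (c *: p + q)) ->
  forall p, P p.
Proof.
move=> P0 P1 PX PD; elim/mpolyind => // c m p _ _ Pp; apply: PD => // {p Pp}.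
elim/mnm_ind: m => [|i m IH]; first by rewrite mpolyX0.
by rewrite mpolyXD; apply: PX.
Qed.

Lemma mderiv_var i j : ('X_j : {mpoly F[n]})^`M(i) = (i == j)%:R.
Proof.
rewrite mderivX mnm1E eq_sym; case: eqVneq => [->|_]; last by rewrite scale0r.
have -> : (U_(j) - U_(j) = 0)%MM by rewrite -{1}[U_(j)%MM]add0m addmK.
by rewrite scale1r mpolyX0.
Qed.

(** This is the commutation relation of the Weyl algebra: bracketing an
    operator with the variable X_i differentiates its symbol in y_i. *)
Lemma apolar_act_mulX phi i f :
  apolar_act phi ('X_i * f) = 'X_i * apolar_act phi f + apolar_act phi^`M(i) f.
Proof.
elim/mpoly_indX: phi => [||j phi IH|c phi psi IHphi IHpsi].
- by rewrite mderiv0 !apolar_act0l mulr0 addr0.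
- by rewrite -mpolyC1 mderivC mpolyC1 !apolar_act1 apolar_act0l addr0.
- rewrite !apolar_actM !apolar_actX IH mderivD mderivM mderiv_var.
  rewrite mderivM mderiv_var [j == i]eq_sym.
  rewrite apolar_actDl !apolar_actM apolar_actX.
  rewrite [in RHS]addrCA addrA; congr (_ + _ + _).
  by case: eqP => _; rewrite ?mul1r ?mul0r ?apolar_act1 ?apolar_act0l.
- rewrite mderivD mderivZ !apolar_actDl !apolar_actZl IHphi IHpsi.
  by rewrite mulrDr scalerDr scalerAr addrACA.
Qed.

End ApolarModule.

(** * Divided powers of the quadratic form and of a linear form *)

Section Unfolding.
Variables (F : fieldType) (n : nat).

Lemma qform_dpowE k :
  qform_dpow F n k = ((2 ^ k * k`!)%:R)^-1 *: qform F n ^+ k :> {mpoly F[n]}.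
Proof. by []. Qed.

Lemma linform_dpowE (a : 'rV[F]_n) k :
  linform_dpow a k = (k`!%:R)^-1 *: linform a ^+ k :> {mpoly F[n]}.
Proof. by []. Qed.

End Unfolding.

(* Simplification would otherwise expose the scalars and powers under the
   projection to polynomials. *)
#[local] Opaque qform_dpow linform_dpow.

Section DividedPowers.
Variables (F : numFieldType) (n : nat).
Implicit Types (phi f : {mpoly F[n]}) (a : 'rV[F]_n) (m : 'X_{1..n}).

Local Notation Q k := (mpoly_of_dhomog (qform_dpow F n k)).
Local Notation L a k := (mpoly_of_dhomog (linform_dpow a k)).

Lemma mderiv_exp f i k : (f ^+ k.+1)^`M(i) = k.+1%:R *: (f ^+ k * f^`M(i)).
Proof.
elim: k => [|k IH]; first by rewrite !expr1 expr0 mul1r scale1r.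
rewrite exprS mderivM IH -scalerAr mulrA -exprS mulrC.
by rewrite -[in RHS]natr1 scalerDl scale1r addrC.
Qed.

Lemma mderiv_qform i : (qform F n)^`M(i) = 2%:R *: 'X_i.
Proof.
rewrite raddf_sum (bigD1 i) //= big1 => [|j ji]; last first.
  by rewrite mderiv_exp mderiv_var eq_sym (negbTE ji) mulr0 scaler0.
by rewrite mderiv_exp mderiv_var eqxx mulr1 expr1 addr0.
Qed.

Lemma mderiv_linform a i : (linform a)^`M(i) = (a 0 i)%:MP.
Proof.
rewrite raddf_sum (bigD1 i) //= big1 => [|j ji]; last first.
  by rewrite mderivZ mderiv_var eq_sym (negbTE ji) scaler0.
by rewrite mderivZ mderiv_var eqxx addr0 -mul_mpolyC mulr1.
Qed.

Lemma qform_dpow0 : Q 0 = 1 :> {mpoly F[n]}.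
Proof. by rewrite qform_dpowE expr0 invr1 scale1r. Qed.

Lemma linform_dpow0 a : L a 0 = 1 :> {mpoly F[n]}.
Proof. by rewrite linform_dpowE expr0 fact0 invr1 scale1r. Qed.

(** The normalization by 2^k k! is the one that makes this hold without a
    scalar: Q_k is the k-th term of e^{q/2}. *)
Lemma mderiv_qform_dpow k i : (Q k.+1)^`M(i) = 'X_i * Q k.
Proof.
rewrite !qform_dpowE mderivZ mderiv_exp mderiv_qform -!scalerAr !scalerA.
rewrite [_ * 'X_i]mulrC.
congr (_ *: _); rewrite factS expnS !natrM !invfM.
by field; rewrite nat1r !pnatr_eq0 expn_eq0 -lt0n fact_gt0.
Qed.

Lemma mderiv_linform_dpow a k i :
  (L a k.+1)^`M(i) = a 0 i *: L a k.
Proof.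
rewrite !linform_dpowE mderivZ mderiv_exp mderiv_linform mulrC mul_mpolyC.
rewrite !scalerA; congr (_ *: _); rewrite factS natrM.
by field; rewrite nat1r !pnatr_eq0 -lt0n fact_gt0.
Qed.

Lemma apolar_linform_dpowX m a k :
  apolar_act 'X_[m] (L a (mdeg m + k)) =
  ('X_[m] : {mpoly F[n]}).@[a 0] *: L a k.
Proof.
elim/mnm_ind: m k => [|i m IH] k.
  by rewrite mdeg0 mpolyX0 apolar_act1 meval1 scale1r.
rewrite mdegD mdeg1 mpolyXD mevalM mevalXU [_ * 'X_[m]]mulrC apolar_actM.
by rewrite add1n addSn apolar_actX mderiv_linform_dpow linearZ /= IH scalerA.
Qed.

Lemma apolar_linform_dpow phi a d k : phi \is d.-homog ->
  apolar_act phi (L a (d + k)) = phi.@[a 0] *: L a k.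
Proof.
move=> /dhomogP phid; rewrite [phi in LHS]mpolyE [phi in RHS]mpolyE.
rewrite apolar_act_suml raddf_sum scaler_suml /= !big_seq.
apply: eq_bigr => m /phid /= md.
by rewrite apolar_actZl mevalZ -scalerA -md apolar_linform_dpowX.
Qed.

Lemma apolar_linform a f : apolar_act (linform a) f = \sum_i a 0 i *: f^`M(i).
Proof.
rewrite apolar_act_suml; apply: eq_bigr => i _.
by rewrite apolar_actZl apolar_actX.
Qed.

Lemma apolar_linform_mul a f g :
  apolar_act (linform a) (f * g) =
  apolar_act (linform a) f * g + f * apolar_act (linform a) g.
Proof.
rewrite !apolar_linform mulr_suml mulr_sumr -big_split; apply: eq_bigr => i _.
by rewrite mderivM scalerDr scalerAl scalerAr.
Qed.

(** L(d) is a derivation and L(d) L = a . a. *)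
Lemma apolar_linform_self a k :
  isotropic a -> apolar_act (linform a) (linform a ^+ k) = 0.
Proof.
move=> a0; elim: k => [|k IH].
  rewrite expr0 apolar_linform big1 // => i _.
  by rewrite -mpolyC1 mderivC scaler0.
rewrite exprS apolar_linform_mul IH mulr0 addr0 apolar_linform.
rewrite (_ : \sum_i _ = (\sum_i a 0 i ^+ 2)%:MP).
  by rewrite a0 mpolyC0 mul0r.
rewrite raddf_sum; apply: eq_bigr => i _.
by rewrite mderiv_linform -mul_mpolyC -mpolyCM.
Qed.

Lemma apolar_linform_qform_dpow a k :
  apolar_act (linform a) (Q k.+1) = linform a * Q k.
Proof.
rewrite apolar_linform mulr_suml; apply: eq_bigr => i _.
by rewrite mderiv_qform_dpow scalerAl.
Qed.

Lemma apolar_linformX_qform_dpow a j k : isotropic a ->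
  apolar_act (linform a ^+ j) (Q (j + k)) = linform a ^+ j * Q k.
Proof.
move=> a0; elim: j k => [|j IH] k; first by rewrite !expr0 apolar_act1 mul1r.
rewrite exprS apolar_actM addSnnS IH apolar_linform_mul apolar_linform_self //.
by rewrite mul0r add0r apolar_linform_qform_dpow mulrCA mulrA.
Qed.

Lemma meval_linform_isotropic a : isotropic a -> (linform a).@[a 0] = 0.
Proof.
rewrite /isotropic => a0; rewrite -[RHS]a0 raddf_sum; apply: eq_bigr => i _.
by rewrite /= mevalZ mevalXU expr2.
Qed.

(** As Q_k lowers degrees by 2k, the bound is far from sharp; it is the one that
    matches the range of summation in [apolar_actX_qform_dpow]. *)
Lemma apolar_qform_dpow_eq0 k m : (mdeg m < k)%N ->
  apolar_act (Q k) 'X_[m] = 0.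
Proof.
elim/mnm_ind: m k => [|i m IH] [|k] // lt_mk.
  rewrite qform_dpowE apolar_actZl exprSr apolar_actM mpolyX0 -mpolyC1.
  rewrite apolar_act_suml big1 ?linear0 ?scaler0 // => i _.
  by rewrite expr2 apolar_actM !apolar_actX mderivC mderiv0.
move: lt_mk; rewrite mdegD mdeg1 add1n ltnS => lt_mk.
rewrite mpolyXD apolar_act_mulX IH ?leqW // mulr0 add0r.
by rewrite mderiv_qform_dpow apolar_actM IH // linear0.
Qed.

(** The shift t is what makes the induction on m possible: replacing X^m by
    X_i X^m differentiates the formula for t + 1.  The Leibniz rule then splits
    each term in two, which match the two terms of the Weyl relation in
    Q_k o (X_i X^m), the second one with k shifted by one. *)
Lemma apolar_actX_qform_dpow m t :
  apolar_act 'X_[m] (Q (mdeg m + t)) =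
  \sum_(k < (mdeg m).+1) Q (t + k) * apolar_act (Q k) 'X_[m].
Proof.
elim/mnm_ind: m t => [|i m IH] t.
  rewrite mdeg0 big_ord1 mpolyX0 !addn0 !apolar_act1 qform_dpow0.
  by rewrite apolar_act1 mulr1.
rewrite mpolyXD mdegD mdeg1 add1n apolar_actM addSnnS IH apolar_actX raddf_sum.
under [RHS]eq_bigr do rewrite apolar_act_mulX mulrDr.
(* The surplus term of the first sum, k = deg m + 1, vanishes for degree
   reasons, and that of the second, k = 0, because Q_0 is constant. *)
rewrite [RHS]big_split.
rewrite [X in _ = X + _]big_ord_recr [X in _ = _ + X]big_ord_recl.
rewrite /= apolar_qform_dpow_eq0 // !mulr0 addr0.
rewrite qform_dpow0 -mpolyC1 mderivC.
rewrite apolar_act0l mulr0 add0r -big_split; apply: eq_bigr => k _ /=.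
rewrite mderivM addSn !mderiv_qform_dpow apolar_actM apolar_actX addnS.
by rewrite mulrA [_ * 'X_i]mulrC.
Qed.

Lemma apolar_act_qform_dpow phi d : phi \is d.-homog ->
  apolar_act phi (Q d) = \sum_(k < d.+1) Q k * apolar_act (Q k) phi.
Proof.
move=> /dhomogP phid.
rewrite [phi in LHS]mpolyE apolar_act_suml [LHS]big_seq.
have Qphi k : Q k * apolar_act (Q k) phi =
    \sum_(m <- msupp phi | m \in msupp phi)
      phi@_m *: (Q k * apolar_act (Q k) 'X_[m]).
  rewrite -big_seq {1}[phi]mpolyE linear_sum mulr_sumr; apply: eq_bigr => m _.
  by rewrite linearZ scalerAr.
under [RHS]eq_bigr do rewrite Qphi.
rewrite [RHS]exchange_big /=; apply: eq_bigr => m /phid /= <-.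
rewrite apolar_actZl -[mdeg m in LHS]addn0 apolar_actX_qform_dpow.
exact: scaler_sumr.
Qed.

End DividedPowers.

(** * The Fischer product and injectivity *)

Section Fischer.
Variables (C : numClosedFieldType) (n : nat).
Implicit Types (phi f : {mpoly C[n]}).

Local Notation conj := (map_mpoly Num.conj).
Local Notation Q k := (mpoly_of_dhomog (qform_dpow C n k)).

Lemma conj_apolar_act phi f :
  conj (apolar_act phi f) = apolar_act (conj phi) (conj f).
Proof.
pose k := maxn (msize phi) (msize (conj phi)).
rewrite !(@apolar_actE _ _ _ _ k) ?leq_max ?leqnn ?orbT // raddf_sum.
apply: eq_bigr => m _ /=; rewrite map_mpolyZ mcoeff_map_mpoly; congr (_ *: _).
apply/mpolyP => l.
by rewrite mcoeff_map_mpoly !mcoeff_mderivm raddfMn mcoeff_map_mpoly.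
Qed.

Lemma conj_qform_dpow k : conj (Q k) = Q k.
Proof.
rewrite qform_dpowE map_mpolyZ fmorphV rmorph_nat rmorphXn /=.
congr (_ *: _ ^+ _); rewrite raddf_sum; apply: eq_bigr => i _ /=.
by rewrite rmorphXn /= map_mpolyX.
Qed.

(** The square of the norm for the Fischer product; conjugating the coefficients
    is what makes it positive. *)
Definition fischer_norm phi : C := (apolar_act phi (conj phi))@_0%MM.

Lemma fischer_normE phi :
  fischer_norm phi =
  \sum_(m <- msupp phi) `|phi@_m| ^+ 2 *+ \prod_(i < n) (m i)`!.
Proof.
rewrite /fischer_norm raddf_sum; apply: eq_bigr => m _ /=.
rewrite mcoeffZ mcoeff_mderivm addm0 mcoeff_map_mpoly mulrnAr -normCK.
by congr (_ *+ _); apply: eq_bigr => i _; rewrite ffactnn.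
Qed.

Lemma fischer_norm_ge0 phi : 0 <= fischer_norm phi.
Proof.
rewrite fischer_normE; apply: sumr_ge0 => m _.
by rewrite mulrn_wge0 // exprn_ge0.
Qed.

Lemma fischer_norm_eq0 phi : fischer_norm phi = 0 -> phi = 0.
Proof.
rewrite fischer_normE => /eqP; rewrite psumr_eq0 => [/allP h|m _]; last first.
  by rewrite mulrn_wge0 // exprn_ge0.
apply/eqP; rewrite -msupp_eq0; case E: (msupp phi) => [//|m r].
have mphi : m \in msupp phi by rewrite E mem_head.
have := h m mphi; rewrite /= mulrn_eq0 sqrf_eq0 normr_eq0.
rewrite -[phi@_m == 0]negbK -mcoeff_msupp mphi orbF.
by rewrite eqn0Ngt prodn_gt0 // => i; rewrite fact_gt0.
Qed.

(** Multiplication by Q_k is adjoint to its action, Q_k having real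
    coefficients. *)
Lemma qform_dpow_mul_adjoint k phi :
  (apolar_act (Q k * apolar_act (Q k) phi) (conj phi))@_0%MM =
  fischer_norm (apolar_act (Q k) phi).
Proof.
by rewrite mulrC apolar_actM /fischer_norm conj_apolar_act conj_qform_dpow.
Qed.

(** The Fischer product of phi o Q_d with phi is a sum of nonnegative terms, the
    first of which, for k = 0, is the norm of phi. *)
Lemma apolar_qform_dpow_inj d phi : phi \is d.-homog ->
  apolar_act phi (Q d) = 0 -> phi = 0.
Proof.
move=> phid eq0; apply: fischer_norm_eq0.
have : \sum_(k < d.+1) fischer_norm (apolar_act (Q k) phi) = 0.
  transitivity ((apolar_act (apolar_act phi (Q d)) (conj phi))@_0%MM);
    last by rewrite eq0 apolar_act0l mcoeff0.
  rewrite (apolar_act_qform_dpow phid) apolar_act_suml raddf_sum.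
  by apply: eq_bigr => k _; rewrite -qform_dpow_mul_adjoint.
move/eqP; rewrite psumr_eq0 => [/allP/(_ ord0)|k _];
  last exact: fischer_norm_ge0.
by rewrite mem_index_enum qform_dpow0 apolar_act1 => /(_ isT)/eqP.
Qed.

Local Notation L a k := (mpoly_of_dhomog (linform_dpow a k)).

(** Let L^s act on both sides.  The left becomes phi o L^s, which is s! phi(a);
    the right vanishes since L(a) = a . a. *)
Lemma apolar_eq_meval_isotropic (a : 'rV[C]_n) s phi :
    (0 < s)%N -> isotropic a -> phi \is s.-homog ->
  apolar_act phi (Q s) = phi.@[a 0] *: L a s -> phi.@[a 0] = 0.
Proof.
move=> s_gt0 a0 phis eqQL.
have Ls : linform a ^+ s \is s.-homog.
  by rewrite -[s in s.-homog]mul1n; apply/dhomogMn/linform_homog.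
have : apolar_act (linform a ^+ s) (apolar_act phi (Q s)) = 0.
  rewrite eqQL linearZ /= -[s in L a s]addn0 (apolar_linform_dpow _ _ Ls).
  rewrite rmorphXn /= meval_linform_isotropic // expr0n gtn_eqF //.
  by rewrite scale0r scaler0.
rewrite apolar_actC -[s in Q s]addn0 apolar_linformX_qform_dpow //.
rewrite qform_dpow0 mulr1.
have -> : linform a ^+ s = s`!%:R *: L a (s + 0).
  rewrite addn0 linform_dpowE scalerA divff ?scale1r //.
  by rewrite pnatr_eq0 -lt0n fact_gt0.
rewrite linearZ /= (apolar_linform_dpow _ _ phis) linform_dpow0 scalerA.
move/eqP; rewrite scaler_eq0 oner_eq0 orbF mulf_eq0 pnatr_eq0.
by rewrite -leqn0 leqNgt fact_gt0 => /eqP.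
Qed.

Lemma apolar_qform_sub_linform_inj (a : 'rV[C]_n) s phi :
    (0 < s)%N -> isotropic a -> phi \is s.-homog ->
  apolar_act phi (Q s - L a (2 * s)) = 0 -> phi = 0.
Proof.
move=> s_gt0 a0 phis.
have -> : L a (2 * s) = L a (s + s) by rewrite mul2n addnn.
rewrite linearB /= apolar_linform_dpow //.
move=> /subr0_eq eqQL; apply: (apolar_qform_dpow_inj phis).
by rewrite eqQL (apolar_eq_meval_isotropic s_gt0 a0 phis eqQL) scale0r.
Qed.

End Fischer.

Lemma full_rank_injective (F : fieldType) (U : vectType F) (h : 'Hom(U, U)) :
  (forall u, h u = 0 -> u = 0) -> full_rank h.
Proof.
move=> h_inj; rewrite /full_rank minnn limg_dim_eq //; apply/eqP.
rewrite -subv0 capfv; apply/subvP => u; rewrite memv_ker memv0 => /eqP /h_inj.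
by move=> ->.
Qed.

Theorem lemma4p12 (R : realType) (n s : nat) (hs : (1 <= s)%N)
    (a : 'rV[R[i]]_n.+1) (ha : isotropic a) :
  full_rank (Cat (qform_dpow R[i] n.+1 s - linform_dpow a (2 * s))).
Proof.
apply: full_rank_injective => phi.
move=> /(congr1 (@mpoly_of_dhomog _ _ _)); rewrite CatE raddf0 => eq0.
apply/val_inj/(apolar_qform_sub_linform_inj hs ha (dhomog_is_dhomog phi)).
exact: eq0.
Qed.
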